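(* Let $A=(a_{ij})\in\mathbb{R}^{2\times 2}$ be a matrix with all entries finite, and let $$K=\{(b_{11},b_{12},b_{21},b_{22})\in\overline{\mathbb{R}}^4 : A\otimes B=B\otimes A\},\qquad B=\begin{bmatrix} b_{11}&b_{12}\\ b_{21}&b_{22}\end{bmatrix}.$$ Then $K$ has a basis consisting of at most $6$ vectors.
   Context: $\overline{\mathbb{R}}=\mathbb{R}\cup\{-\infty\}$ carries the tropical (max-plus) operations $a\oplus b=\max(a,b)$ and $a\otimes b=a+b$, with $-\infty$ as additive identity. Matrix products are $(A\otimes B)_{ij}=\max_k(a_{ik}+b_{kj})$. For $\lambda\in\overline{\mathbb{R}}$ and $v\in\overline{\mathbb{R}}^d$, $\lambda\otimes v$ is the vector with entries $\lambda+v_i$, and $\oplus$ of vectors is the entrywise maximum. A tropical linear combination of a set $S\subseteq\overline{\mathbb{R}}^d$ is a vector $\bigoplus_{w\in S}\lambda_w\otimes w$ with $\lambda_w\in\overline{\mathbb{R}}$ and only finitely many $\lambda_w>-\infty$; $\operatorname{span}(S)$ is the set of all of them. A set $S$ is independent if no element of $S$ is a tropical linear combination of the other elements of $S$. A basis of $K$ is an independent set $S\subseteq K$ with $\operatorname{span}(S)=K$. *)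

(* Defs.v *)
From HB Require Import structures.
From mathcomp Require Import all_boot all_order all_algebra.
From mathcomp Require Import all_classical reals.

Set Implicit Arguments.
Unset Strict Implicit.
Unset Printing Implicit Defensive.

Import Order.TTheory GRing.Theory Num.Theory.
Local Open Scope ring_scope.
Local Open Scope classical_set_scope.

(* R with -oo adjoined; [None] is -oo. The ring-scope notations at this type
   are the tropical ones: [+] is max, [*] is +, [0] is -oo and [1] is the real
   number 0, so [*m], [*:] and [\sum] are tropical as well. *)
Definition trop (R : realType) : Type := option R.

Definition fin (R : realType) (a : R) : trop R := Some a.

HB.instance Definition _ (R : realType) := Choice.copy (trop R) (option R).

Section TropSemiring.
Variable R : realType.
Implicit Types x y z : trop R.

Definition tadd x y : trop R :=
  match x, y with
  | None, _ => y
  | _, None => x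
  | Some a, Some b => Some (Num.max a b)
  end.

Definition tmul x y : trop R :=
  match x, y with
  | Some a, Some b => Some (a + b)
  | _, _ => None
  end.

Let tzero : trop R := None.
Let tone : trop R := Some 0.

Fact taddA : associative tadd.
Proof. by move=> [a|] [b|] [c|] //=; rewrite maxA. Qed.

Fact taddC : commutative tadd.
Proof. by move=> [a|] [b|] //=; rewrite maxC. Qed.

Fact tadd0 : left_id tzero tadd.
Proof. by case. Qed.

Fact tmulA : associative tmul.
Proof. by move=> [a|] [b|] [c|] //=; rewrite addrA. Qed.

Fact tmulC : commutative tmul.
Proof. by move=> [a|] [b|] //=; rewrite addrC. Qed.

Fact tmul1 : left_id tone tmul.
Proof. by case=> [a|] //=; rewrite add0r. Qed.

Fact tmulDl : left_distributive tmul tadd.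
Proof. by move=> [a|] [b|] [c|] //=; rewrite addr_maxl. Qed.

Fact tmul0 : left_zero tzero tmul.
Proof. by []. Qed.

Fact tone_neq0 : tone != tzero.
Proof. by []. Qed.

HB.instance Definition _ := GRing.isNmodule.Build (trop R) taddA taddC tadd0.
HB.instance Definition _ := GRing.Nmodule_isComNzSemiRing.Build (trop R)
  tmulA tmulC tmul1 tmulDl tmul0 tone_neq0.

End TropSemiring.

Section Span.
Variables (R : realType) (d : nat).
Implicit Types (S K : set 'rV[trop R]_d) (v : 'rV[trop R]_d).

(* [lam w <> 0] says that the coefficient of [w] is greater than -oo. *)
Definition tspan S : set 'rV[trop R]_d :=
  [set v | exists lam : 'rV[trop R]_d -> trop R,
    finite_set (S `&` [set w | lam w <> 0]) /\
    v = \sum_(w \in S) lam w *: w].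

Definition tindependent S : Prop :=
  forall w, S w -> ~ tspan (S `\ w) w.

Definition tbasis S K : Prop :=
  [/\ S `<=` K, tindependent S & tspan S = K].

End Span.

(* Row-major: (b11, b12, b21, b22) is sent to [b11 b12; b21 b22]. *)
Definition mx_of_vec (R : realType) (v : 'rV[trop R]_4) : 'M[trop R]_2 :=
  \matrix_(i < 2, j < 2) v ord0 (inord (2 * i + j)).

Definition commuting (R : realType) (A : 'M[R]_2) : set 'rV[trop R]_4 :=
  [set v | map_mx (@fin R) A *m mx_of_vec v = mx_of_vec v *m map_mx (@fin R) A].

(* Main.v *)
Require Import Defs.
From mathcomp Require Import all_boot all_order all_algebra.
From mathcomp Require Import all_classical reals.
From mathcomp Require Import finmap lra ring.

(** Rescaling b12 and b21 turns the commutation equations into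
    [x + T p = x + T q], [w + E T p = w + E T q], [w + E p = x + p],
    [w + E q = x + q] in tropical notation, with [E = a / d] and
    [T = b c / (a d)]. An equality [x + u = x + v] forces [u = v] or that [x]
    absorbs both [u] and [v]; hence, unless [p = q], the diagonal entries [x]
    and [w] absorb [T p], [T q], resp. [E T p], [E T q]. This gives four generators
    when [E] is not the unit and six when it is, and their supports are so
    different that none is a combination of the others. *)

Import Order.TTheory GRing.Theory Num.Theory.

Local Open Scope classical_set_scope.
Local Open Scope card_scope.

Section Trop.
Set Implicit Arguments.
Unset Strict Implicit.
Local Open Scope ring_scope.
Variable R : realType.

(** * Absence of cancellation, and spans of finite sets *)

Lemma trop_add_eq0 (x y : trop R) : x + y = 0 -> x = 0 /\ y = 0.
Proof. by case: x => [?|]; case: y => [?|]. Qed.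

Lemma trop_mul_neq0 (x y : trop R) : x <> 0 -> y <> 0 -> x * y <> 0.
Proof. by case: x => [?|] //; case: y => [?|]. Qed.

Lemma trop_sum_eq0 (I : eqType) (r : seq I) (F : I -> trop R) :
  \sum_(k <- r) F k = 0 -> {in r, forall k, F k = 0}.
Proof.
elim: r => [|k0 r IH] //; rewrite big_cons => /trop_add_eq0[k00 /IH r0] k.
by rewrite in_cons => /predU1P[->|/r0].
Qed.

Section Dim.
Variable d : nat.
Implicit Types (S K : set 'rV[trop R]_d) (u v w : 'rV[trop R]_d).

(** Over a finite set every coefficient function is admissible; here it is 0 (the tropical unit) at
    [w] and -oo elsewhere. *)
Lemma tspan_gen S w : finite_set S -> S w -> tspan S w.
Proof.
move=> finS Sw; exists (fun u => if u == w then 1 else 0); split.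
  exact: finite_setIl.
rewrite (fsbigD1 w) //= eqxx scale1r fsbig1 ?addr0 // => u [_ /eqP/negbTE ->].
by rewrite scale0r.
Qed.

Lemma tspanD S u v : finite_set S -> tspan S u -> tspan S v -> tspan S (u + v).
Proof.
move=> finS [l [_ ->]] [m [_ ->]]; exists (fun w => l w + m w); split.
  exact: finite_setIl.
by rewrite -fsbig_split //; apply: eq_fsbigr => w _; rewrite scalerDl.
Qed.

Lemma tspanZ S a v : finite_set S -> tspan S v -> tspan S (a *: v).
Proof.
move=> finS [l [_ ->]]; exists (fun w => a * l w); split.
  exact: finite_setIl.
rewrite !fsbig_finite // scaler_sumr.
by apply: eq_bigr => w _; rewrite scalerA.
Qed.

Lemma tspan_sub S K : finite_set S -> S `<=` K -> K 0 ->
  (forall u v, K u -> K v -> K (u + v)) ->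
  (forall a v, K v -> K (a *: v)) -> tspan S `<=` K.
Proof.
move=> finS SK K0 KD KZ v [l [_ ->]]; rewrite fsbig_finite // big_seq.
by apply: big_ind => // w; rewrite in_fset_set // => /set_mem/SK; apply: KZ.
Qed.

(* Sums do not cancel, so a combination equal to [w] only involves vectors
   whose support lies in that of [w]. *)
Lemma not_tspan_support S w i : finite_set S -> w ord0 i <> 0 ->
  (forall u, S u -> (exists2 j, w ord0 j = 0 & u ord0 j <> 0) \/ u ord0 i = 0) ->
  ~ tspan S w.
Proof.
move=> finS wi0 Su [l [_ ew]]; apply: wi0.
have wE j : w ord0 j = \sum_(u <- fset_set S) l u * u ord0 j.
  rewrite {1}ew fsbig_finite // summxE.
  by apply: eq_bigr => u _; rewrite mxE.
rewrite wE big_seq big1 // => u uS.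
have [[j wj uj]|->] : (exists2 j, w ord0 j = 0 & u ord0 j <> 0) \/ u ord0 i = 0.
- by apply: Su; move: uS; rewrite in_fset_set // => /set_mem.
- have [->|l0] := pselect (l u = 0); first by rewrite mul0r.
  move: wj; rewrite wE => /trop_sum_eq0/(_ u uS).
  by move/(trop_mul_neq0 l0 uj).
- by rewrite mulr0.
Qed.

End Dim.

(** * Coordinates of [commuting A] and its closure under spans *)

Definition row4 (x y z w : trop R) : 'rV[trop R]_4 :=
  \row_j nth None [:: x; y; z; w] j.

Lemma row4_eta (v : 'rV[trop R]_4) : exists x y z w, v = row4 x y z w.
Proof.
exists (v ord0 (inord 0)), (v ord0 (inord 1)), (v ord0 (inord 2)),
  (v ord0 (inord 3)).
apply/rowP => -[[|[|[|[|//]]]] lt4]; rewrite mxE /=;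
  by congr (v _ _); apply/val_inj; rewrite /= inordK.
Qed.

Lemma row4D x y z w x' y' z' w' :
  row4 x y z w + row4 x' y' z' w' = row4 (x + x') (y + y') (z + z') (w + w').
Proof. by apply/rowP => -[[|[|[|[|//]]]] lt4]; rewrite !mxE. Qed.

Lemma row4Z a x y z w :
  a *: row4 x y z w = row4 (a * x) (a * y) (a * z) (a * w).
Proof. by apply/rowP => -[[|[|[|[|//]]]] lt4]; rewrite !mxE. Qed.

Definition comm_eqs (a b c d x y z w : trop R) : Prop :=
  [/\ a * x + b * z = x * a + y * c, a * y + b * w = x * b + y * d,
      c * x + d * z = z * a + w * c & c * y + d * w = z * b + w * d].

Lemma matrix2P (T : Type) (M N : 'M[T]_2) :
  M = N <-> [/\ M ord0 ord0 = N ord0 ord0, M ord0 ord_max = N ord0 ord_max,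
    M ord_max ord0 = N ord_max ord0 & M ord_max ord_max = N ord_max ord_max].
Proof.
split=> [-> //|[e00 e01 e10 e11]]; apply/matrixP.
have ord2 (P : 'I_2 -> Prop) : P ord0 -> P ord_max -> forall i, P i.
  by move=> P0 P1 -[[|[|//]] i2]; [have := P0 | have := P1]; congr P; apply: val_inj.
by apply: (ord2); apply: (ord2).
Qed.

Lemma commutingP (A : 'M[R]_2) x y z w :
  commuting A (row4 x y z w) <->
  comm_eqs (fin (A ord0 ord0)) (fin (A ord0 ord_max))
           (fin (A ord_max ord0)) (fin (A ord_max ord_max)) x y z w.
Proof.
have l0 : lift ord0 ord0 = ord_max :> 'I_2 by apply: val_inj.
apply: iff_trans (matrix2P _ _) _.
by rewrite !(mxE, big_ord_recl, big_ord0, addr0, l0) /= !inordK.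
Qed.

(** Both products of [A] with [B], left and right, are tropically linear in [B]. *)
Lemma tspan_commuting (A : 'M[R]_2) (S : set 'rV[trop R]_4) :
  finite_set S -> S `<=` commuting A -> tspan S `<=` commuting A.
Proof.
move=> finS SA.
have mxD u v : @mx_of_vec R (u + v) = mx_of_vec u + mx_of_vec v.
  by apply/matrixP => i j; rewrite !mxE.
have mxZ a v : @mx_of_vec R (a *: v) = a *: mx_of_vec v.
  by apply/matrixP => i j; rewrite !mxE.
have mx0 : @mx_of_vec R 0 = 0 by apply/matrixP => i j; rewrite !mxE.
apply: tspan_sub => // [|u v|a v]; rewrite /commuting /=.
- by rewrite mx0 mulmx0 mul0mx.
- by rewrite mxD mulmxDl mulmxDr => -> ->.
- by rewrite mxZ -scalemxAl -scalemxAr => ->.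
Qed.

Lemma card_seq_le (T : choiceType) (x0 : T) (s : seq T) n :
  (size s <= n)%N -> [set` s] #<= `I_n.
Proof.
move=> sn; apply: card_le_trans (card_image_le (nth x0 s) `I_n).
apply: subset_card_le => x /= xs; exists (index x s); last exact: nth_index.
by apply: leq_trans sn; rewrite index_mem.
Qed.

(** * Normalised equations and their solutions *)

Implicit Types x y z w p q u v : trop R.

Lemma finD (a b : R) : fin a + fin b = fin (Num.max a b).
Proof. by []. Qed.

Lemma finM (a b : R) : fin a * fin b = fin (a + b).
Proof. by []. Qed.

(** If [u] and [v] differ, the larger one cannot exceed [x], since otherwise only one side would
    reach it. *)
Lemma trop_add_cancel x u v : x + u = x + v -> u = v \/ x + u = x /\ x + v = x.
Proof.
case: x u v => [x|] [u|] [v|] //; rewrite ?finD; try by auto.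
by case=> h; have [->|/eqP uv] := eqVneq u v; [left|right];
  split; apply: (congr1 Some); move: h; do 2 case: leP => ?; lra.
Qed.

Lemma fin_mulI (k : R) x y : fin k * x = fin k * y -> x = y.
Proof. by case: x y => [x|] [y|] // [] /addrI ->. Qed.

(** For finite [p] the left side is at least [fin e * p], which exceeds [p], so the maximum on the
    right is attained by [x] alone. *)
Lemma trop_absorb (e : R) x p w : 0 < e -> w + fin e * p = x + p ->
  x = w + fin e * p.
Proof.
move=> e0; case: x p w => [x|] [p|] [w|] //; rewrite ?finM ?finD ?add0r //.
- by case; do 2 case: leP => ?; move=> h; apply: (congr1 Some); lra.
- by case; case: leP => ? h; apply: (congr1 Some); lra.
- by case; case: leP => ? h; exfalso; lra.
- by case=> ?; exfalso; lra.
Qed.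

Definition norm_eqs (E T : trop R) x p q w : Prop :=
  [/\ x + T * p = x + T * q, w + E * T * p = w + E * T * q,
      w + E * p = x + p & w + E * q = x + q].

(** The four entries of the matrix equation, read row by row, are the normalised equations 1, 3, 4
    and 2 multiplied by [a], [b], [c] and [d], up to swapping sides. These factors are finite, so
    they cancel. *)
Lemma commuting_norm (A : 'M[R]_2) x p q w :
  let a := A ord0 ord0 in let b := A ord0 ord_max in
  let c := A ord_max ord0 in let d := A ord_max ord_max in
  commuting A (row4 x (fin (b - d) * p) (fin (c - d) * q) w) <->
  norm_eqs (fin (a - d)) (fin (b + c - a - d)) x p q w.
Proof.
move=> a b c d; rewrite commutingP -/a -/b -/c -/d /comm_eqs /norm_eqs.
have aE : fin a = fin (a - d) * fin d.
  by rewrite finM; apply: (congr1 Some); lra.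
have bE : fin b = fin (b - d) * fin d.
  by rewrite finM; apply: (congr1 Some); lra.
have cE : fin c = fin (c - d) * fin d.
  by rewrite finM; apply: (congr1 Some); lra.
have aT : fin a * fin (b + c - a - d) = fin (b - d) * fin d * fin (c - d).
  by rewrite !finM; apply: (congr1 Some); lra.
have TE : fin (a - d) * fin (b + c - a - d) = fin (b - d) * fin (c - d).
  by rewrite !finM; apply: (congr1 Some); lra.
rewrite TE.
have fI (k : R) u v u' v' : u = fin k * u' -> v = fin k * v' -> (u = v <-> u' = v').
  by move=> -> ->; split=> [/fin_mulI|->].
have e1 : fin a * x + fin b * (fin (c - d) * q) =
    x * fin a + fin (b - d) * p * fin c <->
    x + fin (b + c - a - d) * q = x + fin (b + c - a - d) * p.
  by apply: (fI a); rewrite mulrDr [in RHS]mulrA aT ?bE ?cE; ring.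
have e2 : fin a * (fin (b - d) * p) + fin b * w =
    x * fin b + fin (b - d) * p * fin d <-> w + fin (a - d) * p = x + p.
  by apply: (fI b); rewrite ?aE bE; ring.
have e3 : fin c * x + fin d * (fin (c - d) * q) =
    fin (c - d) * q * fin a + w * fin c <-> x + q = w + fin (a - d) * q.
  by apply: (fI c); rewrite ?aE cE; ring.
have e4 : fin c * (fin (b - d) * p) + fin d * w =
    fin (c - d) * q * fin b + w * fin d <->
    w + fin (b - d) * fin (c - d) * p = w + fin (b - d) * fin (c - d) * q.
  by apply: (fI d); rewrite ?bE ?cE; ring.
split=> [[/e1 n1 /e2 n3 /e3 n4 /e4 n2]|[n1 n2 n3 n4]]; first by split.
by split; [apply/e1|apply/e2|apply/e3|apply/e4].
Qed.

Lemma trop_absorbD w p u v :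
  w + u * p = w -> w + v * p = w -> w + p * (u + v) = w.
Proof. by move=> wu wv; rewrite mulrDr addrA ![p * _]mulrC wu wv. Qed.

(** The last two equations give two expressions for [x], namely [w + fin e * p] and [w + fin e * q].
    Cancelling between them, and then in the second equation, leaves [p = q] or a [w] that absorbs
    all the terms in [p] and [q]. *)
Lemma norm_eqs_gt (e t : R) x p q w : 0 < e ->
  norm_eqs (fin e) (fin t) x p q w ->
  (p = q /\ x = w + fin e * p) \/
  [/\ x = w, w + p * (fin e + fin e * fin t) = w &
      w + q * (fin e + fin e * fin t) = w].
Proof.
move=> e0 [_ n2 /(trop_absorb e0) xp /(trop_absorb e0) xq].
have [/fin_mulI pq|[wp wq]] := trop_add_cancel (etrans (esym xp) xq).
  by left.
have [|[wp' wq']] := trop_add_cancel n2.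
  by rewrite finM => /fin_mulI pq; left.
by right; split; [rewrite xp | apply: trop_absorbD | apply: trop_absorbD].
Qed.

Lemma norm_eqs_lt (e t : R) x p q w : e < 0 ->
  norm_eqs (fin e) (fin t) x p q w ->
  (p = q /\ w = x + p) \/
  [/\ x = w, x + p * (1 + fin t) = x & x + q * (1 + fin t) = x].
Proof.
move=> e0 [n1 _ n3 n4].
have eN : 0 < - e by lra.
have eK u : fin (- e) * (fin e * u) = u.
  by rewrite mulrA finM addNr mul1r.
(* Seen from [fin e * u], the term [u] is its multiple by the positive [- e], so absorption applies
   with [x] and [w] exchanged. *)
have wE u : w + fin e * u = x + u -> w = x + u.
  by move=> n; rewrite -[u]eK; apply: (trop_absorb eN); rewrite eK.
have [pq|[xp xq]] := trop_add_cancel (etrans (esym (wE _ n3)) (wE _ n4)).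
  by left; split=> //; apply: wE.
have [/fin_mulI pq|[xp' xq']] := trop_add_cancel n1.
  by left; split=> //; apply: wE.
by right; split; [rewrite (wE _ n3) | apply: trop_absorbD; rewrite ?mul1r ..].
Qed.

(** By the last two equations, either [x = w] or each of [p] and [q] absorbs both [x] and [w]. When
    [p] and [q] differ, the first two equations also make [x] and [w] absorb [fin t * p] and
    [fin t * q]. *)
Lemma norm_eqs_eq (t : R) x p q w : norm_eqs 1 (fin t) x p q w ->
  [\/ p = q /\ x = w,
      p = q /\ p + x + w = p,
      [/\ x = w, x + p * fin t = x & x + q * fin t = x] |
      [/\ p + x + w = p, q + x + w = q, x + (p + q) * fin t = x &
          w + (p + q) * fin t = w]].
Proof.
move=> [n1 n2 n3 n4]; rewrite !mul1r in n2 n3 n4.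
have xw_or u : w + u = x + u -> w = x \/ u + w = u /\ u + x = u.
  by move=> n; apply: trop_add_cancel; rewrite addrC n addrC.
have [pq|pq] := eqVneq p q.
  by case: (xw_or _ n3) => [->|[pw px]]; [apply: Or41 | apply: Or42; rewrite px].
have tpq : fin t * p <> fin t * q by move=> /fin_mulI /eqP; apply/negP.
have [//|[xp xq]] := trop_add_cancel n1.
have [//|[wp wq]] := trop_add_cancel n2.
have [xw|[pw px]] := xw_or _ n3.
  by apply: Or43; rewrite ![_ * fin t]mulrC.
have [xw|[qw qx]] := xw_or _ n4.
  by apply: Or43; rewrite ![_ * fin t]mulrC.
by apply: Or44; rewrite px qx [_ * fin t]mulrC mulrDr !addrA xp wp.
Qed.

End Trop.

(** * Explicit bases, according to the sign of [a - d] *)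

Section Basis.
Set Implicit Arguments.
Unset Strict Implicit.
Variables (R : realType) (A : 'M[R]_2).
Local Open Scope ring_scope.

Let a := A ord0 ord0.
Let b := A ord0 ord_max.
Let c := A ord_max ord0.
Let d := A ord_max ord_max.
Let e : R := a - d.
Let t : R := b + c - a - d.
(** The scalings are finite, so supports can be read off from [x], [p], [q] and [w]. *)
Let vec (x p q w : trop R) := row4 x (fin (b - d) * p) (fin (c - d) * q) w.

Let comm_vec x p q w :
  commuting A (vec x p q w) <-> norm_eqs (fin e) (fin t) x p q w.
Proof. exact: commuting_norm. Qed.

Let vec_eta v : exists x p q w, v = vec x p q w.
Proof.
have [x [y [z [w ->]]]] := row4_eta v.
exists x, (fin (d - b) * y), (fin (d - c) * z), w.
have K (f g : R) u : u = fin (f - g) * (fin (g - f) * u).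
  by rewrite mulrA finM subrKA subrr mul1r.
by rewrite /vec -!K.
Qed.

(** The last hypothesis certifies independence: [w] is finite at [i], while any other generator is
    -oo at [i] or has a support that excludes it from combinations equal to [w]. *)
Lemma tbasis_seq (s : seq 'rV[trop R]_4) :
  (size s <= 6)%N -> [set` s] `<=` commuting A ->
  (forall x p q w, norm_eqs (fin e) (fin t) x p q w ->
     tspan [set` s] (vec x p q w)) ->
  (forall w, w \in s -> exists2 i, w ord0 i <> 0 & forall u, u \in s ->
    u = w \/ (exists2 j, w ord0 j = 0 & u ord0 j <> 0) \/ u ord0 i = 0) ->
  exists S : set 'rV[trop R]_4, tbasis S (commuting A) /\ S #<= `I_6.
Proof.
move=> s6 sA As ind; exists [set` s]; split; last exact: (card_seq_le 0).
split=> // [w /= /ind[i wi0 iP]|].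
  apply: (not_tspan_support (i := i)) => // [|u [/= us uw]].
    exact: finite_setD.
  by case: (iP u us).
apply/seteqP; split; first exact: tspan_commuting.
by move=> v; have [x [p [q [w ->]]]] := vec_eta v => /comm_vec /As.
Qed.

Let trop1 : 1 = fin 0 :> trop R.
Proof. by []. Qed.

Let o1 : 'I_4 := Ordinal (isT : 1 < 4)%N.
Let o2 : 'I_4 := Ordinal (isT : 2 < 4)%N.

Let vecD x p q w x' p' q' w' :
  vec x p q w + vec x' p' q' w' = vec (x + x') (p + p') (q + q') (w + w').
Proof. by rewrite /vec row4D !mulrDr. Qed.

Let vecZ k x p q w : k *: vec x p q w = vec (k * x) (k * p) (k * q) (k * w).
Proof. by rewrite /vec row4Z ![k * (fin _ * _)]mulrCA. Qed.

Ltac in_span :=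
  repeat (apply: tspanD; [exact: finite_seq| |]);
  (apply: tspanZ; [exact: finite_seq|]);
  (apply: tspan_gen; [exact: finite_seq|]);
  by rewrite /= !inE eqxx ?orbT.

(** Innermost maxima are split first, so that every comparison is linear and usable by [lra]. *)
Ltac split_max :=
  match goal with |- context [Num.max ?u ?v] =>
    lazymatch constr:((u, v)) with
    | context [Num.max _ _] => fail
    | _ => case: (leP u v) => ?
    end
  end.

Ltac check_norm := apply/comm_vec; split;
  rewrite ?(mulr0, mulr1, addr0, add0r) // ?trop1 ?(finM, finD) //;
  apply: (congr1 Some); repeat split_max; lra.

Ltac check_support :=
  first [by left
        |by right; right; rewrite !mxE
        |by right; left; exists ord0; rewrite !mxE
        |by right; left; exists o1; rewrite !mxE
        |by right; left; exists o2; rewrite !mxE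
        |by right; left; exists ord_max; rewrite !mxE].

Ltac case_in :=
  rewrite !inE; repeat (case/predU1P => [->|]); try move/eqP->.

(** The constant [m] is the least diagonal entry that absorbs both bounds when [p] or [q] is the
    unit; the fourth generator is the solution with [p = q = 1] and [w] equal to -oo. *)
Lemma basis_gt : 0 < e ->
  exists S : set 'rV[trop R]_4, tbasis S (commuting A) /\ S #<= `I_6.
Proof.
move=> e0; pose m : trop R := fin (Num.max e (e + t)).
have mE : fin e + fin e * fin t = m by [].
apply: (tbasis_seq (s :=
  [:: vec 1 0 0 1; vec m 1 0 m; vec m 0 1 m; vec (fin e) 1 1 0])) => //.
- by move=> v /=; case_in; check_norm.
- move=> x p q w /(norm_eqs_gt e0)[[<- ->]|[->]].
    have ->: vec (w + fin e * p) p p w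
        = w *: vec 1 0 0 1 + p *: vec (fin e) 1 1 0.
      by rewrite !vecZ vecD; congr vec; ring.
    by in_span.
  rewrite mE => wp wq.
  have ->: vec w p q w = w *: vec 1 0 0 1 + p *: vec m 1 0 m + q *: vec m 0 1 m.
    by rewrite !vecZ !vecD !(mulr1, mulr0, addr0, add0r) wp wq.
  by in_span.
- move=> w; case_in; [exists ord0|exists o1|exists o2|exists ord0];
    solve [by rewrite !mxE | by move=> u; case_in; check_support].
Qed.

(** Now [w = x + p] when [p = q], so the fourth generator has [x] equal to -oo instead. *)
Lemma basis_lt : e < 0 ->
  exists S : set 'rV[trop R]_4, tbasis S (commuting A) /\ S #<= `I_6.
Proof.
move=> e0; pose m : trop R := fin (Num.max 0 t).
have mE : 1 + fin t = m by [].
apply: (tbasis_seq (s :=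
  [:: vec 1 0 0 1; vec m 1 0 m; vec m 0 1 m; vec 0 1 1 1])) => //.
- by move=> v /=; case_in; check_norm.
- move=> x p q w /(norm_eqs_lt e0)[[<- ->]|[<-]].
    have ->: vec x p p (x + p) = x *: vec 1 0 0 1 + p *: vec 0 1 1 1.
      by rewrite !vecZ vecD; congr vec; ring.
    by in_span.
  rewrite mE => xp xq.
  have ->: vec x p q x = x *: vec 1 0 0 1 + p *: vec m 1 0 m + q *: vec m 0 1 m.
    by rewrite !vecZ !vecD !(mulr1, mulr0, addr0, add0r) xp xq.
  by in_span.
- move=> w; case_in; [exists ord0|exists o1|exists o2|exists ord_max];
    solve [by rewrite !mxE | by move=> u; case_in; check_support].
Qed.

Lemma basis_eq : e = 0 ->
  exists S : set 'rV[trop R]_4, tbasis S (commuting A) /\ S #<= `I_6.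
Proof.
move=> e0; pose m : trop R := fin t.
apply: (tbasis_seq (s := [:: vec 1 0 0 1; vec m 1 0 m; vec m 0 1 m;
  vec 0 1 1 0; vec 1 1 1 0; vec 0 1 1 1])) => //.
- by move=> v /=; case_in; check_norm.
- move=> x p q w; rewrite e0 => /norm_eqs_eq[
    [<- ->] | [<- pxw] | [-> wp wq] | [pxw qxw xpq wpq]].
  + have ->: vec w p p w = w *: vec 1 0 0 1 + p *: vec 0 1 1 0.
      by rewrite !vecZ vecD; congr vec; ring.
    by in_span.
  + have ->: vec x p p w = p *: vec 0 1 1 0 + x *: vec 1 1 1 0 + w *: vec 0 1 1 1.
      by rewrite !vecZ !vecD !(mulr1, mulr0, addr0, add0r) pxw.
    by in_span.
  + have ->: vec w p q w
        = w *: vec 1 0 0 1 + p *: vec m 1 0 m + q *: vec m 0 1 m.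
      by rewrite !vecZ !vecD !(mulr1, mulr0, addr0, add0r) wp wq.
    by in_span.
  (* The first two summands add [(p + q) * m] to the diagonal, where [x] and [w] absorb it; the last
     two add [x + w] off the diagonal, where [p] and [q] absorb it. *)
  + have ->: vec x p q w = p *: vec m 1 0 m + q *: vec m 0 1 m
        + x *: vec 1 1 1 0 + w *: vec 0 1 1 1.
      rewrite !vecZ !vecD !(mulr1, mulr0, addr0, add0r) -mulrDl pxw qxw.
      by rewrite ![(p + q) * _ + _]addrC xpq wpq.
    by in_span.
- move=> w; case_in;
    [exists ord0|exists o1|exists o2|exists o1|exists ord0|exists ord_max];
    solve [by rewrite !mxE | by move=> u; case_in; check_support].
Qed.

End Basis.

Theorem theorem1 (R : realType) (A : 'M[R]_2) :
  exists S : set 'rV[trop R]_4, tbasis S (commuting A) /\ S #<= `I_6.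
Proof.
have [e0|e0|e0] := ltgtP (A ord0 ord0 - A ord_max ord_max)%R 0%R.
- exact: basis_lt.
- exact: basis_gt.
- exact: basis_eq.
Qed.
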